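(* Let $\pi=u\cdot v\in B_n$ with $$u=\tau_{i_1}^{k_1}\cdot\tau_{i_2}^{k_2}\cdots\tau_{i_m}^{k_m},\qquad v=\tau_{i_{m+1}}^{i_{m+1}},$$ where $u$ is an element of $\dot S_n$ presented by its generalized standard $OGS$ presentation, $i_m\le i_{m+1}\le n$ (so $v$ is the longest element of the parabolic subgroup generated by $\{s_0,s_1,\dots,s_{i_{m+1}-1}\}$). Then the descent set of $\pi$ satisfies the following: - for $0\le j<i_m$: $j\in des(u\cdot v)\iff j\notin des(u)$; - for $i_m\le j<i_{m+1}$: $j\in des(u\cdot v)$.
   Context: $B_n$ is the group of signed permutations, i.e. the bijections $\pi$ of $\{\pm1,\dots,\pm n\}$ with $\pi(-i)=-\pi(i)$. It is a Coxeter group with generators $s_0,\dots,s_{n-1}$, where $s_0$ exchanges $1$ and $-1$, and for $1\le i\le n-1$, $s_i$ exchanges $i$ with $i+1$ and $-i$ with $-(i+1)$. Products are read from left to right: $(\pi_1\cdot\pi_2)(i)=\pi_2(\pi_1(i))$. $\dot S_n$ is the subgroup generated by $s_1,\dots,s_{n-1}$. For $1\le k\le n$, $\tau_k=s_0s_1\cdots s_{k-1}$. Every element of $B_n$ has a unique presentation $\tau_1^{e_1}\cdots\tau_n^{e_n}$ with integers $-k\le e_k<k$, called its generalized standard $OGS$ presentation; it is written omitting trivial factors, with strictly increasing subscripts (here $i_1<\dots<i_m$, with exponents $k_1,\dots,k_m$). The descent set is $des(\pi)=\{0\le i\le n-1:\pi(i)>\pi(i+1)\}$ with $\pi(0):=0$;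 equivalently $i\in des(\pi)$ iff $\ell(s_i\cdot\pi)<\ell(\pi)$, where $\ell$ is the Coxeter length. *)

(* Defs.v *)
From HB Require Import structures.
From mathcomp Require Import all_boot all_order all_algebra all_fingroup.
From mathcomp Require Import zify.

Set Implicit Arguments.
Unset Strict Implicit.
Unset Printing Implicit Defensive.

Import Order.TTheory GRing.Theory Num.Theory GroupScope.

Record signed (n : nat) := Signed {
  sint : int;
  sint_prop : (sint != 0%R) && (`|sint| <= n)%N }.

HB.instance Definition _ n := [isSub for @sint n].
HB.instance Definition _ n := [Countable of signed n by <:].

Section SignedFinite.
Variable n : nat.

Definition signed_code (x : signed n) : 'I_n.*2.+1 :=
  inord `|(sint x + n%:Z)%R|%N.

Definition signed_decode (k : 'I_n.*2.+1) : option (signed n) :=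
  insub (k%:Z - n%:Z)%R.

Lemma signed_codeK : pcancel signed_code signed_decode.
Proof.
move=> x; rewrite /signed_decode -[RHS]valK; congr insub.
by case: x => x px; rewrite /signed_code -[val _]/x /= inordK; lia.
Qed.

HB.instance Definition _ : isFinite (signed n) := PCanIsFinite signed_codeK.

Lemma sopp_proof (x : signed n) :
  (- sint x != 0)%R && (`|(- sint x)%R| <= n)%N.
Proof. by rewrite oppr_eq0 abszN; case: x. Qed.

Definition sopp (x : signed n) : signed n := Signed (sopp_proof x).

Definition signed_perms : {set {perm signed n}} :=
  [set p : {perm signed n} | [forall x, p (sopp x) == sopp (p x)]].

Lemma signed_perms_group_set : group_set signed_perms.
Proof.
apply/group_setP; split=> [|p q].
  by rewrite inE; apply/forallP => x; rewrite !perm1.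
rewrite !inE => /forallP hp /forallP hq; apply/forallP => x.
by rewrite !permM (eqP (hp x)) (eqP (hq _)).
Qed.
Canonical signed_perms_group := Group signed_perms_group_set.

End SignedFinite.

(* The product of permutations in MathComp is read from left to right:
   (p * q) x = q (p x). *)
Definition B (n : nat) : finGroupType := subg_of (signed_perms_group n).

(* p(i), extended by p(0) = 0 (and by 0 outside {-n, ..., n}). *)
Definition bval (n : nat) (p : B n) (i : int) : int :=
  if insub i is Some x then sint (sgval p x) else 0%R.

Section Generators.
Variables (n : nat) (i : nat).

Definition exchange : int -> int :=
  (if i == 0%N then [eta id with 1 |-> - 1, - 1 |-> 1]
   else [eta id with i%:Z |-> i.+1%:Z, i.+1%:Z |-> i%:Z,
                     - i%:Z |-> - i.+1%:Z, - i.+1%:Z |-> - i%:Z])%R.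

Lemma exchangeK x : x != 0%R -> exchange (exchange x) = x.
Proof.
rewrite /exchange; case: (i =P 0%N) => /= [_|i0] x0;
  do ?[case: (x =P _) => ?]; do ?[case: eqP => ?]; lia.
Qed.

(* For i >= n, where s_i is not defined, this is the identity. *)
Definition gen_fun (x : signed n) : signed n := insubd x (exchange (sint x)).

Lemma sint_gen_fun x :
  sint (gen_fun x) = if (i < n)%N then exchange (sint x) else sint x.
Proof.
change (val (insubd x (exchange (sint x))) =
        if (i < n)%N then exchange (sint x) else sint x).
rewrite val_insubd; change (val x) with (sint x); rewrite /exchange.
case: x => x /= px; case: (i =P 0%N) => /= [->|i0];
  do ?[case: (x =P _) => ?]; do ?[case: ifP => ?]; lia.
Qed.

Lemma gen_funK : involutive gen_fun.
Proof.
move=> x; apply: val_inj; change (sint (gen_fun (gen_fun x)) = sint x).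
rewrite sint_gen_fun [sint (gen_fun x)]sint_gen_fun; case: (i < n)%N => //.
by apply: exchangeK; case: x => x /= /andP[].
Qed.

Definition gen_perm : {perm signed n} := perm (inv_inj gen_funK).

Lemma gen_perm_signed : gen_perm \in signed_perms_group n.
Proof.
rewrite inE; apply/forallP => x; rewrite !permE; apply/eqP/val_inj.
change (sint (gen_fun (sopp x)) = (- sint (gen_fun x))%R).
rewrite !sint_gen_fun /=; case: ifP => // _.
case: x => x /= /andP[x0 _]; rewrite /exchange; case: (i =P 0%N) => /= [_|i0];
  do ?[case: (x =P _) => ?]; do ?[case: eqP => ?]; lia.
Qed.

Definition s : B n := Subg gen_perm_signed.

End Generators.

Definition dotS (n : nat) : {group B n} :=
  <<[set s n (j : nat) | j : 'I_n & (0 < j)%N]>>%G.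

Definition tau (n k : nat) : B n := \prod_(0 <= j < k) s n j.

Definition zexpg (gT : finGroupType) (x : gT) (e : int) : gT :=
  match e with Posz m => x ^+ m | Negz m => x ^- m.+1 end.

(* w = [:: (i_1, k_1); ...; (i_m, k_m)] stands for
   tau_{i_1}^{k_1} ... tau_{i_m}^{k_m}; the empty list presents the identity. *)
Definition OGS_presentation (n : nat) (w : seq (nat * int)) (u : B n) : Prop :=
  [/\ sorted ltn (unzip1 w),
      forall i k, (i, k) \in w ->
        [/\ (1 <= i <= n)%N, (- i%:Z <= k < i%:Z)%R & k != 0%R] &
      u = \prod_(ik <- w) zexpg (tau n ik.1) ik.2].

Definition des (n : nat) (p : B n) : {set 'I_n} :=
  [set i : 'I_n | (bval p i.+1%:Z < bval p i%:Z)%R].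

(* Main.v *)
(* In one-line notation, [tau_r] sends [1] to [-r] and [x] to [x - 1] for
   [1 < x <= r], so [tau_r ^ r] negates every [x] with [|x| <= r].  On the other
   hand [u] only involves [tau_i] with [i <= im], so it fixes every [x] with
   [|x| > im] and therefore preserves [{x : |x| <= im}].  Hence [pi = - u] on the
   relevant range: the descents below [im] are complemented, and for
   [im <= j < r] we have [pi (j + 1) = - (j + 1) < - |u j| <= pi j]. *)
Require Import Defs.
From mathcomp Require Import all_boot all_order all_algebra all_fingroup zify.
Import Order.TTheory GRing.Theory Num.Theory GroupScope.

Set Implicit Arguments.
Unset Strict Implicit.
Unset Printing Implicit Defensive.

Section WindowValues.
Variable n : nat.
Implicit Types (p q : B n) (x y : int).

Lemma bval0 p : bval p 0 = 0%R.
Proof. by rewrite /bval insubF. Qed.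

Lemma bval_sint p (z : signed n) : bval p (sint z) = sint (sgval p z).
Proof. by rewrite /bval (_ : insub (sint z) = Some z) //; exact: valK. Qed.

(** Holds for every integer [x]: off the domain the inner value is the default 0, and [bval q] keeps
    0 at 0. *)
Lemma bvalM p q x : bval (p * q) x = bval q (bval p x).
Proof.
rewrite {1 3}/bval; case: insub => [z|]; last by rewrite bval0.
by rewrite bval_sint morphM ?inE // permM.
Qed.

Lemma bval1 x : (`|x| <= n)%N -> bval (1 : B n) x = x.
Proof.
move=> le_xn; rewrite /bval; case: insubP => [z _ <-|]; first by rewrite morph1 perm1.
by rewrite le_xn andbT negbK => /eqP.
Qed.

Lemma bvalN p x : bval p (- x)%R = (- bval p x)%R.
Proof.
rewrite {2}/bval; case: insubP => [z _ <-|x_out].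
  rewrite -[(- _)%R]/(sint (sopp z)) bval_sint.
  by have := subgP p; rewrite inE => /forallP/(_ z)/eqP ->.
by rewrite /bval insubN ?oppr0 // oppr_eq0 abszN.
Qed.

Lemma bval_bound p x : (`|bval p x| <= n)%N.
Proof. by rewrite /bval; case: insub => // z; case: (sgval p z) => y /= /andP[]. Qed.

(** The bounds matter, since all integers beyond [n] share the default value 0. *)
Lemma bval_inj p x y :
  (`|x| <= n)%N -> (`|y| <= n)%N -> bval p x = bval p y -> x = y.
Proof.
move=> le_xn le_yn /(congr1 (bval p^-1)).
by rewrite -!bvalM mulgV !bval1.
Qed.

Lemma bval_s i x :
  (i < n)%N -> x != 0%R -> (`|x| <= n)%N -> bval (s n i) x = exchange i x.
Proof.
move=> lt_in x0 le_xn; have x_in : (x != 0%R) && (`|x| <= n)%N by rewrite x0.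
rewrite -[x in LHS]/(sint (Signed x_in)) bval_sint /= permE sint_gen_fun.
by rewrite lt_in.
Qed.

Lemma bval_tau k (x : nat) : (k < n)%N -> (1 <= x <= n)%N ->
  bval (tau n k.+1) x =
    (if x == 1%N then - k.+1%:Z else if (x <= k.+1)%N then x.-1%:Z else x%:Z)%R.
Proof.
elim: k => [|k IHk] lt_kn x_bnd.
  rewrite /tau big_nat1 bval_s; try lia.
  rewrite /exchange /=; do ?[case: eqP => ?]; do ?[case: ifP => ?]; lia.
(* The new last factor [s n k.+1] acts on values: it turns [-(k+1)] into [-(k+2)], lowers [k+2] to
   [k+1], and leaves the smaller values alone. *)
rewrite /tau big_nat_recr //= bvalM -/(tau n k.+1) IHk //; last exact: ltnW.
case: (x =P 1%N) => x1; last case: ifP => le_xk; rewrite bval_s; try lia;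
  by rewrite /exchange /=; do ?[case: eqP => ?]; do ?[case: ifP => ?]; lia.
Qed.

(** [tau n r] is a cyclic shift down by one with a sign change, [1] being followed by [-r]. In
    [m <= r] steps a positive [x] makes this jump at most once, exactly when [x <= m]. *)
Lemma bval_tauX r m (x : nat) : (m <= r <= n)%N -> (1 <= x <= r)%N ->
  bval (tau n r ^+ m) x =
    (if (x <= m)%N then - (r - m + x)%N%:Z else (x - m)%N%:Z)%R.
Proof.
case: r => [|r]; first by lia.
elim: m => [|m IHm] m_bnd x_bnd; first by rewrite expg0 bval1; try case: ifP; lia.
rewrite expgSr bvalM IHm; try lia.
case: ifP => le_xm; last by rewrite bval_tau; do ?[case: eqP => ?]; do ?[case: ifP => ?]; lia.
by rewrite bvalN bval_tau; do ?[case: eqP => ?]; do ?[case: ifP => ?]; lia.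
Qed.

Lemma bval_tauXr r x :
  (r <= n)%N -> (`|x| <= r)%N -> bval (tau n r ^+ r) x = (- x)%R.
Proof.
move=> le_rn; suff pos (y : nat) : (y <= r)%N -> bval (tau n r ^+ r) y = (- y%:Z)%R.
  by case: (intP x) => [|k|k] le_xr; rewrite ?bvalN pos //; lia.
case: y => [|y] le_yr; first by rewrite bval0.
by rewrite bval_tauX; try case: ifP; lia.
Qed.

(** Making this a subgroup settles products and negative powers of the [tau n i] at once, without a
    formula for their values. *)
Definition fix_above k : {set B n} :=
  [set p : B n | [forall z : signed n, (k < `|sint z|)%N ==> (sgval p z == z)]].

Lemma fix_above_group_set k : group_set (fix_above k).
Proof.
apply/group_setP; split=> [|p q].
  by rewrite inE; apply/forallP => z; rewrite morph1 perm1 eqxx implybT.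
rewrite !inE => /forallP fix_p /forallP fix_q; apply/forallP => z; apply/implyP => lt_kz.
rewrite morphM ?inE // permM (eqP (implyP (fix_p z) lt_kz)).
exact: implyP (fix_q z) lt_kz.
Qed.
Canonical fix_above_group k := Group (fix_above_group_set k).

Lemma fix_aboveP k p :
  reflect (forall x, (k < `|x| <= n)%N -> bval p x = x) (p \in fix_above k).
Proof.
rewrite inE; apply: (iffP forallP) => [fix_p x /andP[lt_kx le_xn]|fix_p z].
  have x_in : (x != 0%R) && (`|x| <= n)%N by lia.
  rewrite -[x]/(sint (Signed x_in)) bval_sint.
  by rewrite (eqP (implyP (fix_p (Signed x_in)) lt_kx)).
apply/implyP => lt_kz; apply/eqP/val_inj; rewrite -[LHS]bval_sint fix_p //.
by rewrite lt_kz; case: z {lt_kz} => x /= /andP[].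
Qed.

(** If the image of [x] exceeded [k] in absolute value, [p] would fix it, so by injectivity it would
    equal [x]. *)
Lemma fix_above_bound k p x :
  p \in fix_above k -> (`|x| <= k <= n)%N -> (`|bval p x| <= k)%N.
Proof.
move=> /fix_aboveP fix_p /andP[le_xk le_kn]; rewrite leqNgt; apply/negP => lt_k.
have /bval_inj eq_px : bval p (bval p x) = bval p x.
  by rewrite fix_p // lt_k bval_bound.
by move: lt_k; rewrite eq_px ?bval_bound ?(leq_trans le_xk) // ltnNge le_xk.
Qed.

Lemma tau_fix_above i k : (i <= k)%N -> (i <= n)%N -> tau n i \in fix_above k.
Proof.
case: i => [|i] le_ik le_in; first by rewrite /tau big_geq // group1.
apply/fix_aboveP => x /andP[lt_kx le_xn].
case: (intP x) lt_kx le_xn => [//|m|m]; rewrite ?bvalN => lt_kx le_xn;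
  by rewrite bval_tau; do ?[case: eqP => ?]; do ?[case: ifP => ?]; lia.
Qed.

Lemma OGS_fix_above w (u : B n) :
  OGS_presentation w u -> u \in fix_above (last 0%N (unzip1 w)).
Proof.
case=> sorted_w bnd_w ->; rewrite big_seq; apply: group_prod => -[i k] ik_w /=.
have [/andP[_ le_in] _ _] := bnd_w _ _ ik_w.
(* Subscripts increase strictly, so the last one is the largest. *)
have le_i : (i <= last 0 (unzip1 w))%N.
  have : i \in unzip1 w by apply/mapP; exists (i, k).
  move: sorted_w; case/lastP: (unzip1 w) => // t m; rewrite last_rcons.
  rewrite (sorted_pairwise ltn_trans) pairwise_rcons mem_rcons inE.
  case/andP=> /allP lt_m _ /orP[/eqP -> //|/lt_m]; exact: ltnW.
by case: k {ik_w} => m; rewrite /= ?groupV groupX ?tau_fix_above.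
Qed.

End WindowValues.

Theorem theorem6p0p4 (n : nat) (w : seq (nat * int)) (r : nat) (u v pi : B n)
    (im := last 0%N (unzip1 w)) :
  u \in dotS n -> OGS_presentation w u ->
  (1 <= r)%N -> (im <= r)%N -> (r <= n)%N -> v = tau n r ^+ r ->
  pi = u * v ->
  (forall j : 'I_n, (j < im)%N -> (j \in des pi <-> j \notin des u)) /\
  (forall j : 'I_n, (im <= j)%N -> (j < r)%N -> j \in des pi).
Proof.
move=> _ /OGS_fix_above u_fix _ le_im_r le_rn -> ->; rewrite -/im in u_fix.
(* The cutoff [k] is free because the first claim uses [im], while the second needs the sharper
   bounds [j] and [j.+1]. *)
have piE (j k : nat) : (im <= k <= r)%N -> (j <= k)%N ->
    (`|bval u j| <= k)%N /\ bval (u * tau n r ^+ r) j = (- bval u j)%R.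
  move=> k_bnd le_jk.
  have u_bnd : (`|bval u j| <= k)%N.
    have [le_j|lt_j] := leqP j im; last by rewrite (fix_aboveP _ _ u_fix) //; lia.
    by have := fix_above_bound (x := j) u_fix; lia.
  by rewrite bvalM bval_tauXr //; lia.
split=> j lt_j => [|lt_jr]; rewrite !inE.
  have [_ ->] := piE j im ltac:(lia) ltac:(lia).
  have [_ ->] := piE j.+1 im ltac:(lia) ltac:(lia).
  (* Injectivity excludes equal neighbouring values, so negation exchanges descents and ascents. *)
  have := @bval_inj _ u j.+1 j ltac:(lia) ltac:(lia).
  by split; lia.
have [u_bnd ->] := piE j j ltac:(lia) ltac:(lia).
have [_ ->] := piE j.+1 j.+1 ltac:(lia) ltac:(lia).
by rewrite (fix_aboveP _ _ u_fix); lia.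
Qed.
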